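(* For any positive integers $a$ and $k$, $$(-1)^{(a-1)k}m_{a^{k}}=q^{a-1}\sum_{i=1}^{k}C_{ai}\left((-1)^{(a-1)(k-i)}m_{a^{k-i}}\right)+(-1)^{ak}G(a,ak).$$
   Context: $\Lambda$ is the ring of symmetric functions in $X=x_1+x_2+\cdots$ with coefficients in $\mathbb{Q}(q,t)$. $m_\lambda$, $h_n$, $p_n$ are the monomial, complete homogeneous and power sum symmetric functions ($h_0=1$). $m_{a^k}$ is the monomial symmetric function of the partition with $k$ parts equal to $a$; $m_{a^0}=1$. The Petrie symmetric functions are $G(k,n)=\sum_{\lambda\vdash n,\ \lambda_1<k}m_\lambda$. For $b\in\mathbb{Z}$, the operator $C_b:\Lambda\to\Lambda$ is the $\mathbb{Q}(q,t)$-linear operator $$C_{b}f[X]=\left(-\frac{1}{q}\right)^{b-1}f\left[X-\frac{1-\frac1q}{z}\right]\Omega[zX]\Bigg|_{z^b},$$ where $|_{z^b}$ means taking the coefficient of $z^b$, brackets denote plethystic substitution, and $\Omega[zX]=\sum_{n\ge 0}h_n z^n$. Explicitly, $f\left[X-\frac{1-1/q}{z}\right]$ is obtained by writing $f$ as a polynomial in the power sums $p_k$ and replacing each $p_k$ by $p_k-(1-q^{-k})z^{-k}$. *)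

(* Defs.v *)
From HB Require Import structures.
From mathcomp Require Import all_boot all_order all_fingroup all_algebra.
From mathcomp Require Import boolp.
From mathcomp Require Import mpoly.

Set Implicit Arguments.
Unset Strict Implicit.
Unset Printing Implicit Defensive.

Import GRing.Theory.

Local Open Scope ring_scope.

Section SymmetricFunctions.

Variable R : comNzRingType.

Definition kill_last n (p : {mpoly R[n.+1]}) : {mpoly R[n]} :=
  p \mPo [tuple (if unlift ord_max i is Some j then 'X_j else 0) | i < n.+1].

(* The ring of symmetric functions in x_0, x_1, x_2, ... over R, as the graded
   inverse limit of the rings of symmetric polynomials: [f n] is the symmetric
   function f(x_0, ..., x_(n-1), 0, 0, ...). *)
Record symfun := SymFun {
  sfpoly :> forall n : nat, {mpoly R[n]};
  sfpoly_sym : forall n, sfpoly n \is symmetric;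
  sfpoly_compat : forall n, kill_last (sfpoly n.+1) = sfpoly n;
  sfpoly_bounded : exists d : nat, forall n, (msize (sfpoly n) <= d)%N
}.

Lemma symfunP (f g : symfun) : (forall n, f n = g n) -> f = g.
Proof.
case: f g => [f fs fc fb] [g gs gc gb] /= fg.
have {}fg : f = g by apply: functional_extensionality_dep.
subst g; congr SymFun; exact: Prop_irrelevance.
Qed.

HB.instance Definition _ := gen_eqMixin symfun.
HB.instance Definition _ := gen_choiceMixin symfun.

Lemma kill_lastD n : {morph @kill_last n : p q / p + q}.
Proof. by move=> p q; rewrite /kill_last rmorphD. Qed.
Lemma kill_lastN n : {morph @kill_last n : p / - p}.
Proof. by move=> p; rewrite /kill_last rmorphN. Qed.
Lemma kill_lastM n : {morph @kill_last n : p q / p * q}.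
Proof. by move=> p q; rewrite /kill_last rmorphM. Qed.
Lemma kill_last1 n : @kill_last n 1 = 1.
Proof. by rewrite /kill_last rmorph1. Qed.
Lemma kill_last0 n : @kill_last n 0 = 0.
Proof. by rewrite /kill_last rmorph0. Qed.
Lemma kill_lastZ n c p : @kill_last n (c *: p) = c *: kill_last p.
Proof. by rewrite /kill_last linearZ. Qed.

Definition sf0 : symfun.
Proof.
exists (fun n => 0) => [n|n|]; first exact: rpred0.
  exact: kill_last0.
by exists 0%N => n; rewrite mmeasure0.
Defined.

Definition sf1 : symfun.
Proof.
exists (fun n => 1) => [n|n|]; first exact: rpred1.
  exact: kill_last1.
by exists 1%N => n; rewrite -[1]mpolyC1 mmeasureC; case: (_ != _).
Defined.

Definition sfopp (f : symfun) : symfun.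
Proof.
exists (fun n => - f n) => [n|n|]; first by rewrite rpredN sfpoly_sym.
  by rewrite kill_lastN sfpoly_compat.
by have [d fd] := sfpoly_bounded f; exists d => n; rewrite mmeasureN.
Defined.

Definition sfadd (f g : symfun) : symfun.
Proof.
exists (fun n => f n + g n) => [n|n|]; first by rewrite rpredD ?sfpoly_sym.
  by rewrite kill_lastD !sfpoly_compat.
have [d fd] := sfpoly_bounded f; have [e ge] := sfpoly_bounded g.
exists (maxn d e) => n; apply: leq_trans (mmeasureD_le _ _ _) _.
by rewrite geq_max !leq_max fd ge orbT.
Defined.

Definition sfmul (f g : symfun) : symfun.
Proof.
exists (fun n => f n * g n) => [n|n|]; first by rewrite rpredM ?sfpoly_sym.
  by rewrite kill_lastM !sfpoly_compat.
have [d fd] := sfpoly_bounded f; have [e ge] := sfpoly_bounded g.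
exists (d + e).+1 => n.
by apply: leq_trans (msizeM_le _ _) _; rewrite ltnS leq_add.
Defined.

Definition sfscale (c : R) (f : symfun) : symfun.
Proof.
exists (fun n => c *: f n) => [n|n|]; first by rewrite rpredZ ?sfpoly_sym.
  by rewrite kill_lastZ sfpoly_compat.
have [d fd] := sfpoly_bounded f.
by exists d => n; apply: leq_trans (msizeZ_le _ _) _.
Defined.

Fact sfaddA : associative sfadd.
Proof. by move=> f g h; apply: symfunP => n /=; rewrite addrA. Qed.
Fact sfaddC : commutative sfadd.
Proof. by move=> f g; apply: symfunP => n /=; rewrite addrC. Qed.
Fact sfadd0 : left_id sf0 sfadd.
Proof. by move=> f; apply: symfunP => n /=; rewrite add0r. Qed.
Fact sfaddN : left_inverse sf0 sfopp sfadd.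
Proof. by move=> f; apply: symfunP => n /=; rewrite addNr. Qed.
HB.instance Definition _ :=
  GRing.isZmodule.Build symfun sfaddA sfaddC sfadd0 sfaddN.

Fact sfmulA : associative sfmul.
Proof. by move=> f g h; apply: symfunP => n /=; rewrite mulrA. Qed.
Fact sfmulC : commutative sfmul.
Proof. by move=> f g; apply: symfunP => n /=; rewrite mulrC. Qed.
Fact sfmul1 : left_id sf1 sfmul.
Proof. by move=> f; apply: symfunP => n /=; rewrite mul1r. Qed.
Fact sfmulDl : left_distributive sfmul sfadd.
Proof. by move=> f g h; apply: symfunP => n /=; rewrite mulrDl. Qed.
Fact sf1_neq0 : sf1 != sf0.
Proof.
apply/eqP => /(congr1 (fun f : symfun => f 0%N)) /= /eqP.
by rewrite (negbTE (oner_neq0 _)).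
Qed.
HB.instance Definition _ := GRing.Zmodule_isComNzRing.Build symfun
  sfmulA sfmulC sfmul1 sfmulDl sf1_neq0.

Fact sfscaleA c d f : sfscale c (sfscale d f) = sfscale (c * d) f.
Proof. by apply: symfunP => n /=; rewrite scalerA. Qed.
Fact sfscale1 : left_id 1 sfscale.
Proof. by move=> f; apply: symfunP => n /=; rewrite scale1r. Qed.
Fact sfscaleDr : right_distributive sfscale sfadd.
Proof. by move=> c f g; apply: symfunP => n /=; rewrite scalerDr. Qed.
Fact sfscaleDl f : {morph sfscale^~ f : c d / c + d >-> sfadd c d}.
Proof. by move=> c d; apply: symfunP => n /=; rewrite scalerDl. Qed.
HB.instance Definition _ := GRing.Zmodule_isLmodule.Build R symfun
  sfscaleA sfscale1 sfscaleDr sfscaleDl.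
Fact sfscaleAl (c : R) (f g : symfun) : c *: (f * g) = (c *: f) * g.
Proof. by apply: symfunP => n /=; rewrite scalerAl. Qed.
HB.instance Definition _ := GRing.Lmodule_isLalgebra.Build R symfun sfscaleAl.
HB.instance Definition _ := GRing.Lalgebra_isComAlgebra.Build R symfun.

(* Symmetric functions that are sums of distinct monomials: [monsum P d] is the
   sum of the monomials of degree at most d whose nonzero exponents satisfy P. *)
Definition nzparts (s : seq nat) : seq nat := [seq i <- s | i != 0%N].

Definition monsum_poly (P : pred (seq nat)) (d n : nat) : {mpoly R[n]} :=
  \sum_(m : 'X_{1..n < d.+1} | P (nzparts (val (val m)))) 'X_[m].

Lemma mcoeff_monsum P d n (m : 'X_{1..n}) :
  (monsum_poly P d n)@_m = ((mdeg m <= d)%N && P (nzparts (val m)))%:R.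
Proof.
rewrite raddf_sum /=; case: leqP => [md|md] /=; last first.
  rewrite big1 // => i _; rewrite mcoeffX; case: eqP => // im.
  by move: md; rewrite -im ltnNge -ltnS bmdeg.
have mb : (mdeg m < d.+1)%N by [].
rewrite big_mkcond (bigD1 (BMultinom mb)) //= mcoeffX eqxx.
rewrite big1 ?addr0 => [|i im]; first by case: (P _).
case: ifP => // _; rewrite mcoeffX; case: eqP => // e.
by case/eqP: im; apply/val_inj.
Qed.

Lemma mcoeff_kill_last n (p : {mpoly R[n.+1]}) m :
  (kill_last p)@_m = p@_(mnmwiden m).
Proof.
elim/mpolyind: p => [|c m' p _ _ IH]; first by rewrite kill_last0 !mcoeff0.
rewrite kill_lastD kill_lastZ !mcoeffD !mcoeffZ IH; congr (_ * _ + _).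
rewrite /kill_last comp_mpolyX big_ord_recr /= tnth_mktuple unlift_none.
rewrite expr0n (eq_bigr (fun i : 'I_n => 'X_i ^+ m' (widen_ord (leqnSn n) i)))
  => [|i _]; last first.
  rewrite tnth_mktuple; have -> : widen_ord (leqnSn n) i = lift ord_max i.
    by apply: val_inj; rewrite /= /bump leqNgt ltn_ord.
  by rewrite liftK.
pose m1 := [multinom m' (widen_ord (leqnSn n) i) | i < n].
rewrite (eq_bigr (fun i => 'X_i ^+ m1 i)) => [|i _]; last by rewrite mnmE.
rewrite -mpolyXE_id mulr_natr mcoeffMn !mcoeffX -mulrnA mulnb; congr (nat_of_bool _)%:R.
apply/andP/eqP => [[/eqP m1m /eqP m'0]|m'E].
  apply/mnmP=> i; have [j ->|->] := unliftP ord_max i; last first.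
    by rewrite m'0 mnmwiden_ordmax.
  have -> : lift ord_max j = widen_ord (leqnSn n) j.
    by apply: val_inj; rewrite /= /bump leqNgt ltn_ord.
  by rewrite mnmwiden_widen -m1m mnmE.
rewrite m'E mnmwiden_ordmax; split=> //; apply/eqP/mnmP=> i.
by rewrite mnmE m'E mnmwiden_widen.
Qed.

Lemma nzparts_perm n (m : 'X_{1..n}) (s : 'S_n) :
  perm_eq (nzparts (val [multinom m (s i) | i < n])) (nzparts (val m)).
Proof.
apply: perm_filter.
have -> : val (val m) = [seq m i | i <- enum 'I_n].
  have szm : size (val (val m)) = n by exact: size_tuple.
  apply: (@eq_from_nth _ 0%N); first by rewrite size_map size_enum_ord.
  move=> i lt_i; have lt_in : (i < n)%N by rewrite -[X in (_ < X)%N]szm.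
  rewrite (nth_map (Ordinal lt_in)) ?size_enum_ord //.
  by rewrite (mnm_nth 0%N) nth_enum_ord.
rewrite /= (map_comp m s); apply: perm_map.
apply: uniq_perm; first by rewrite map_inj_uniq ?enum_uniq //; apply: perm_inj.
  exact: enum_uniq.
move=> i; rewrite mem_enum; apply/mapP.
by exists (s^-1 i)%g; rewrite ?mem_enum ?permKV.
Qed.

Definition monsum (P : pred (seq nat)) (d : nat)
  (PP : forall s t, perm_eq s t -> P s = P t) : symfun.
Proof.
exists (monsum_poly P d) => [n|n|].
- apply/issymP => s; apply/mpolyP => m; rewrite mcoeff_sym !mcoeff_monsum.
  by rewrite mdeg_mperm (PP _ _ (nzparts_perm m s)).
- apply/mpolyP => m; rewrite mcoeff_kill_last !mcoeff_monsum.
  have -> : nzparts (val (mnmwiden m)) = nzparts (val m).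
    by rewrite /nzparts /= filter_rcons.
  by rewrite /mdeg /= -cats1 big_cat /= big_seq1 addn0.
- exists d.+1 => n; apply: leq_trans (mmeasure_sum _ _ _ _) _.
  by apply/bigmax_leqP => m _; rewrite mmeasureX bmdeg.
Defined.

(* The monomial symmetric function m_l; [mono [::]] is 1. *)
Definition mono (l : seq nat) : symfun :=
  @monsum (fun s => perm_eq s (nzparts l)) (sumn l)
    (fun s t st => permPl st (nzparts l)).

Fact perm_sumn_eq d (s t : seq nat) :
  perm_eq s t -> (sumn s == d) = (sumn t == d).
Proof. by move=> st; rewrite (perm_sumn st). Qed.

(* The complete homogeneous symmetric function h_d. *)
Definition homsym (d : nat) : symfun :=
  @monsum (fun s => sumn s == d) d (@perm_sumn_eq d).

Definition homsymz (d : int) : symfun :=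
  if d is Posz n then homsym n else 0.

(* [psumS k] is the power sum p_(k+1); there is no p_0, since the number of
   variables is not a symmetric function. *)
Definition psumS (k : nat) : symfun.
Proof.
exists (fun n => \sum_(i < n) 'X_i ^+ k.+1) => [n|n|].
- apply/issymP => s; rewrite raddf_sum /= [RHS](reindex_inj (@perm_inj _ s)) /=.
  apply: eq_bigr => i _; rewrite rmorphXn /= msymX; congr ('X_[_] ^+ _).
  by apply/mnmP => j; rewrite !mnmE -(inj_eq (@perm_inj _ s)) permKV.
- rewrite /kill_last raddf_sum big_ord_recr /= rmorphXn /= comp_mpolyXU.
  rewrite -tnth_nth tnth_mktuple unlift_none expr0n addr0.
  apply: eq_bigr => i _; rewrite rmorphXn /= comp_mpolyXU -tnth_nth tnth_mktuple.
  have -> : widen_ord (leqnSn n) i = lift ord_max i.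
    by apply: val_inj; rewrite /= /bump leqNgt ltn_ord.
  by rewrite liftK.
- exists k.+2 => n; apply: leq_trans (mmeasure_sum _ _ _ _) _.
  by apply/bigmax_leqP => i _; rewrite mpolyXn mmeasureX ltnS [X in (X <= _)%N]mdegMn mdeg1 mul1n.
Defined.

Definition is_partition (d : nat) (l : seq nat) : bool :=
  sorted geq l && (sumn l == d).

(* A partition of d is encoded by its parts in weakly decreasing order, padded
   with zeros to length d; [mono] ignores the zeros. *)
Definition petrie (k d : nat) : symfun :=
  \sum_(l : d.-tuple 'I_d.+1 |
      is_partition d (map val l) && (head 0%N (map val l) < k)%N)
    mono (map val l).

End SymmetricFunctions.

(* The field Q(q,t) of rational functions. *)
Definition Qqt : fieldType := {fraction {mpoly rat[2]}}.
Definition q : Qqt := tofrac 'X_ord0.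
Definition t : Qqt := tofrac 'X_ord_max.

Notation Lambda := (symfun Qqt).

(* A polynomial in p_1, ..., p_N; the variable of index i stands for p_(i+1). *)
Definition ppoly := {N : nat & {mpoly Qqt[N]}}.

Definition peval (P : ppoly) : Lambda :=
  mmap (GRing.in_alg Lambda) (fun i => psumS Qqt i) (tagged P).

(* f written as a polynomial in the power sums. Every f has such an expression,
   unique up to unused variables, since Qqt has characteristic 0; hence
   [Cop b f] does not depend on the choice made here. The default value is
   never used. *)
Definition pexpansion (f : Lambda) : ppoly :=
  if pselect (exists P, peval P = f) is left ex then projT1 (cid ex)
  else Tagged (fun N => {mpoly Qqt[N]}) (0 : {mpoly Qqt[0]}).

(* f[X - (1 - 1/q)/z], as a polynomial in the variable 'X = 1/z: each p_k
   becomes p_k - (1 - q^-k) z^-k. *)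
Definition plethsub (P : ppoly) : {poly Lambda} :=
  mmap (polyC \o GRing.in_alg Lambda)
    (fun i => (psumS Qqt i)%:P - ((1 - q^-1 ^+ i.+1)%:A)%:P * 'X^(i.+1)) (tagged P).

(* The coefficient of z^b in (\sum_j g_j z^-j) * (\sum_n h_n z^n) is
   \sum_j g_j h_(b+j), with h_n = 0 for n < 0. *)
Definition Cop (b : int) (f : Lambda) : Lambda :=
  let g := plethsub (pexpansion f) in
  (- q^-1) ^ (b - 1) *: \sum_(j < size g) g`_j * homsymz Qqt (b + j%:Z).

(* Main.v *)
Require Import Defs.
From HB Require Import structures.
From mathcomp Require Import all_boot all_order all_algebra.
From mathcomp Require Import boolp.
From mathcomp Require Import zify ring.
From mathcomp Require Import mpoly.

(** Write m_j for the monomial function of j parts equal to a. These are the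
    elementary symmetric functions in the a-th powers of the variables, so
    their generating series is the product E(u) of the 1 + u x^a. Two
    consequences of this product formula prove the theorem.

    The plethysm. Adding a variable y multiplies E(u) by 1 + u y^a and
    subtracting it divides by the same factor. Subtracting (1 - 1/q)/z adds the
    variable 1/(qz) and removes the variable 1/z, hence, writing g_j for
    m_j[X - (1 - 1/q)/z],
      g_(j+1) + z^-a g_j = m_(j+1) + q^-a z^-a m_j
    ([shift_psums_step]). Removing a variable is not an evaluation of a
    symmetric function, whereas adding c copies of it is one for each natural
    number c. For a fixed expression in the power sums the result is a
    polynomial in c, so an identity that holds for all natural c also holds at
    c = -1. The argument applies to every expression of m_j in the power sums,
    in particular to the one that the operators C_b choose; that one exists at
    all follows from the Newton identities ([mono_psum_expansion]).

    The sum. Taking the coefficient of z^b in g_j Omega[zX] turns the recursion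
    for g_j into v_(j+1)(b) + v_j(b + a) = m_(j+1) h_b + q^-a m_j h_(b + a).
    Up to signs and a common factor, the sum in the theorem is that of the
    v_(k-i)(a i) with weights q^(-a (i-1)), and with these weights the recursion
    collapses it to the sum of the m_(k-i) h_(a i) over 1 <= i <= k
    ([telescope_weights]). Finally
      (1 - x^a u^a) (1 + x u + x^2 u^2 + ...) = 1 + x u + ... + (x u)^(a-1)
    for each variable x, so the alternating sum of all the m_(k-i) h_(a i),
    0 <= i <= k, is the Petrie function ([petrie_mono_homsym]). *)

Import GRing.Theory.
Local Open Scope ring_scope.

(** * Exponents of monomials and partitions *)

Lemma sumn_nzparts (s : seq nat) : sumn (nzparts s) = sumn s.
Proof. by elim: s => //= x s IH; case: eqP => [->|_] /=; rewrite IH. Qed.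

Lemma sumn_mdeg n (m : 'X_{1..n}) : sumn (val (val m)) = mdeg m.
Proof. by rewrite sumnE. Qed.

Lemma nzparts_all n (m : 'X_{1..n}) (P : pred nat) : P 0%N ->
  all P (nzparts (val (val m))) = [forall i, P (m i)].
Proof.
move=> P0; rewrite /nzparts all_filter.
apply/allP/forallP => [mP i|mP x].
  have [->//|mi] := eqVneq (m i) 0%N; rewrite (mnm_nth 0%N).
  have := mP (nth 0%N m i); rewrite mem_nth ?size_tuple // -mnm_nth => /(_ isT).
  by rewrite /= mi.
case/tnthP => i ->; apply/implyP => _; exact: mP.
Qed.

Lemma perm_nzparts (s : seq nat) :
  perm_eq s (nzparts s ++ nseq (size s - size (nzparts s)) 0%N).
Proof.
rewrite perm_sym -(permPr (permEl (perm_filterC (predC1 0%N) s))).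
rewrite perm_cat2l; set z := filter _ s.
have /all_pred1P -> : all (pred1 0%N) z.
  by apply/allP => x; rewrite mem_filter /= negbK => /andP[].
rewrite !size_filter -(count_predC (predC1 0%N) s) addKn.
exact: perm_refl.
Qed.

Fact geq_transitive : transitive geq.
Proof. by move=> x y z /= yx zy; exact: leq_trans zy yx. Qed.

Fact geq_antisymmetric : antisymmetric geq.
Proof. by move=> x y; rewrite /= andbC; exact: anti_leq. Qed.

Definition zero_padding (d : nat) (s : seq nat) : seq nat :=
  sort geq s ++ nseq (d - size s) 0%N.

Lemma sorted_zero_padding d s : sorted geq (zero_padding d s).
Proof.
have geq_total : total geq by move=> x y; exact: leq_total.
rewrite (sorted_pairwise geq_transitive) pairwise_cat -!sorted_pairwise //;
  try exact: geq_transitive.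
rewrite (sort_sorted geq_total) /=; apply/andP; split.
  by apply/allrelP => x y _ /nseqP[-> _].
by elim: (_ - _)%N => //= -[|i] //=.
Qed.

(** Two weakly decreasing sequences with the same entries are equal, so a
    partition is determined by its length and its nonzero parts. Hence no
    monomial occurs twice in a Petrie function. *)
Lemma zero_padding_unique (s l : seq nat) :
  sorted geq l -> perm_eq s (nzparts l) -> l = zero_padding (size l) s.
Proof.
move=> l_sorted s_l; apply: (sorted_eq geq_transitive geq_antisymmetric) => //.
  exact: sorted_zero_padding.
rewrite (permPl (perm_nzparts l)) /zero_padding (perm_size s_l) perm_cat2r.
by rewrite perm_sym perm_sort.
Qed.

(** * Generating products in finitely many variables *)

Section GeneratingProducts.
Variable R : comNzRingType.

(** The product over the variables x of the series in u = 'X with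
    coefficients c_j x^j. Truncating each factor at u^D leaves the coefficients
    up to u^D unchanged and keeps everything polynomial. *)
Definition series_prod (n D : nat) (c : nat -> R) : {poly {mpoly R[n]}} :=
  \prod_(i < n) \poly_(j < D.+1) (c j *: 'X_i ^+ j).

(** Expanding the product gives one term for each choice of exponents, that
    is, for each monomial. *)
Lemma mcoeff_series_prod n D (c : nat -> R) d (m : 'X_{1..n}) : (d <= D)%N ->
  ((series_prod n D c)`_d)@_m = (mdeg m == d)%:R * \prod_(i < n) c (m i).
Proof.
move=> dD; rewrite /series_prod.
under eq_bigr => i _ do rewrite poly_def; rewrite bigA_distr_bigA /=.
pose mn (f : {ffun 'I_n -> 'I_D.+1}) := [multinom (f i : nat) | i < n].
have monE (f : {ffun 'I_n -> 'I_D.+1}) :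
    \prod_i ((c (f i) *: 'X_i ^+ f i) *: 'X^(f i)) =
    ((\prod_i c (f i)) *: 'X_[mn f]) *: 'X^(mdeg (mn f)) :> {poly {mpoly R[n]}}.
  rewrite scaler_prod -(big_morph _ (exprD 'X) (expr0 'X)) /=.
  congr (_ *: 'X^_).
    rewrite scaler_prod [in RHS]mpolyXE_id; congr (_ *: _).
    by apply: eq_bigr => i _; rewrite mnmE.
  by rewrite mdegE; apply: eq_bigr => i _; rewrite mnmE.
under eq_bigr => f _ do rewrite monE.
rewrite coef_sum raddf_sum /=.
have coE (f : {ffun 'I_n -> 'I_D.+1}) :
   ((((\prod_i c (f i)) *: 'X_[mn f]) *: 'X^(mdeg (mn f)))`_d)@_m =
   ((mn f == m) && (mdeg m == d))%:R * \prod_(i < n) c (f i).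
  rewrite coefZ coefXn mulr_natr mcoeffMn mcoeffZ mcoeffX.
  rewrite -mulrnAr -mulrnA mulnb mulrC.
  by case: eqP => //= ->; rewrite [d == _]eq_sym.
under eq_bigr => f _ do rewrite coE.
have [md|md] := eqVneq (mdeg m) d; last first.
  by rewrite mul0r big1 // => f _; rewrite andbF mul0r.
have mi i : (m i < D.+1)%N.
  rewrite ltnS; apply: leq_trans dD; rewrite -md mdegE (bigD1 i) //=.
  exact: leq_addr.
pose f0 := [ffun i => Ordinal (mi i)].
rewrite (bigD1 f0) //= [X in _ + X]big1 ?addr0 => [|f fN].
  have /eqP -> : mn f0 = m by apply/mnmP => i; rewrite mnmE ffunE.
  rewrite /= !mul1r.
  by apply: eq_bigr => i _; rewrite ffunE.
case: eqP => [fm|]; last by rewrite mul0r.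
case/eqP: fN; apply/ffunP => i; apply/val_inj; rewrite ffunE /=.
by rewrite -fm mnmE.
Qed.

Lemma mcoeff_mono l n (m : 'X_{1..n}) : (mono R l n)@_m =
  ((mdeg m <= sumn l)%N && perm_eq (nzparts (val m)) (nzparts l))%:R.
Proof. exact: mcoeff_monsum. Qed.

Lemma homsym0 : homsym R 0 = 1.
Proof.
apply: symfunP => n; apply/mpolyP => m; rewrite mcoeff_monsum mcoeff1 -mdeg_eq0.
by rewrite sumn_nzparts sumn_mdeg leqn0 andbb.
Qed.

Lemma homsym_series n D d : (d <= D)%N ->
  homsym R d n = (series_prod n D (fun=> 1))`_d.
Proof.
move=> dD; apply/mpolyP => m; rewrite mcoeff_series_prod // mcoeff_monsum.
rewrite big1 // mulr1 sumn_nzparts sumn_mdeg.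
by case: ltngtP.
Qed.

Lemma prod_natr_bool n (b : 'I_n -> bool) :
  \prod_(i < n) (b i)%:R = ([forall i, b i])%:R :> R.
Proof.
case: forallP => [bT|/forallP]; first by rewrite big1 // => i _; rewrite bT.
by rewrite negb_forall => /existsP[i /negbTE bi]; rewrite (bigD1 i) //= bi mul0r.
Qed.

Lemma petrie_series n D a d : (0 < a)%N -> (d <= D)%N ->
  petrie R a d n = (series_prod n D (fun j => (j < a)%:R))`_d.
Proof.
move=> a_gt0 dD; apply/mpolyP => m; rewrite mcoeff_series_prod //.
have -> : petrie R a d n = \sum_(l : d.-tuple 'I_d.+1 |
      is_partition d (map val l) && (head 0%N (map val l) < a)%N)
    mono R (map val l) n.
  rewrite /petrie.
  by apply: (big_morph (fun f : symfun R => f n)).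
rewrite (big_morph _ (mcoeffD m) (mcoeff0 _ m)).
rewrite prod_natr_bool -natrM mulnb.
have head_all (l : seq nat) : sorted geq l -> (head 0%N l < a)%N = all (ltn^~ a) l.
  case: l => [|x l] //= xl; case: ltnP => //= xa; symmetry.
  have := order_path_min geq_transitive xl; apply: sub_all => y /= yx.
  exact: leq_ltn_trans yx xa.
have all_perm (l : seq nat) : perm_eq (nzparts m) (nzparts l) ->
    all (ltn^~ a) l = [forall i, m i < a]%N.
  move=> ml; rewrite -(@nzparts_all _ m (ltn^~ a)) // (perm_all _ ml).
  rewrite /nzparts all_filter; apply: eq_all => x /=.
  by case: eqP => // ->.
under eq_bigr => l _ do rewrite mcoeff_mono.
have sum_perm (l : seq nat) : perm_eq (nzparts m) (nzparts l) -> mdeg m = sumn l.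
  by move=> /perm_sumn; rewrite !sumn_nzparts sumn_mdeg.
have [/andP[/eqP md ma]|mN] :=
  boolP ((mdeg m == d) && [forall i, m i < a]%N); last first.
  rewrite big1 // => l /andP[/andP[ls /eqP ld] la]; case: andP => // -[_ ml].
  case/negP: mN; rewrite (sum_perm _ ml) ld eqxx /=.
  by rewrite -(all_perm _ ml) -head_all.
pose s := zero_padding d (nzparts m).
have sz_nz : (size (nzparts m) <= d)%N.
  rewrite -md -sumn_mdeg -sumn_nzparts.
  have : all (predC1 0%N) (nzparts m) by rewrite filter_all.
  by elim: (nzparts _) => //= x s' IH /andP[x0 /IH]; lia.
have sz_s : size s == d by rewrite size_cat size_sort size_nseq subnKC.
have m_s : perm_eq (nzparts m) (nzparts s).
  rewrite /s /zero_padding /nzparts filter_cat [X in _ ++ X](_ : _ = [::]); last first.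
    by elim: (_ - _)%N.
  rewrite cats0 perm_sym -/(nzparts m).
  rewrite (permPl (perm_filter _ (permEl (perm_sort _ _)))).
  by rewrite /nzparts filter_id.
have s_small : all (ltn^~ d.+1) s.
  apply/allP => x xs; rewrite /= ltnS -md (sum_perm _ m_s).
  by rewrite sumnE (big_rem _ xs) leq_addr.
(* the only partition whose monomial function contains the monomial m *)
pose l0 := Tuple (etrans
  (congr1 (eq_op^~ d) (size_map (inord : nat -> 'I_d.+1) s)) sz_s).
have l0E : map val l0 = s.
  rewrite /= -map_comp -[RHS]map_id; apply/eq_in_map => x /(allP s_small) /= xd.
  by rewrite inordK.
rewrite (bigD1 l0) /=; last first.
  rewrite l0E head_all ?sorted_zero_padding // (all_perm _ m_s) ma andbT.
  by rewrite /is_partition sorted_zero_padding -(sum_perm _ m_s) md eqxx.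
rewrite l0E m_s -(sum_perm _ m_s) leqnn.
rewrite big1 ?addr0 // => l /andP[/andP[/andP[ls _] _] lN].
case: andP => // -[_ ml]; case/eqP: lN; apply/val_inj/(inj_map val_inj).
by rewrite l0E (zero_padding_unique _ _ ls ml) size_map size_tuple.
Qed.

(** A monomial with exponents in {0, a} and degree a j has exactly j exponents
    equal to a, which accounts for the factor e ^+ j. The values e = 1 and
    e = -1 give the two generating products that occur below. *)
Lemma mono_series n D a e j : (0 < a)%N -> (a * j <= D)%N ->
  e ^+ j *: mono R (nseq j a) n =
   (series_prod n D (fun i => (i == 0%N)%:R + e * (i == a)%:R))`_(a * j).
Proof.
move=> a_gt0 jD; apply/mpolyP => m; rewrite mcoeff_series_prod // mcoeffZ mcoeff_mono.
have nz_nseq i : nzparts (nseq i a) = nseq i a.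
  by apply/all_filterP/allP => x /nseqP[-> _]; rewrite -lt0n.
have sumn_nseq i : sumn (nseq i a) = (a * i)%N.
  by rewrite sumnE big_nseq; elim: i => [|i IH] /=; rewrite ?muln0 // IH mulnS.
rewrite nz_nseq sumn_nseq.
pose P := fun x : nat => (x == 0%N) || (x == a).
have := @nzparts_all _ m P isT.
have [/forallP m0a m_all|] := boolP [forall i, P (m i)]; last first.
  rewrite negb_forall => /existsP[i]; rewrite negb_or => /andP[/negbTE mi0 /negbTE mia].
  move=> m_all; rewrite [X in _ = _ * X](bigD1 i) //= mi0 mia mulr0 addr0 mul0r mulr0.
  case: andP => [[_ mp]|]; last by rewrite mulr0.
  move: m_all; rewrite (perm_all _ mp) => /negP[].
  by apply/allP => x /nseqP[-> _]; rewrite /P eqxx orbT.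
pose c := (\sum_(i < n) (m i == a))%N.
have -> : \prod_(i < n) ((m i == 0)%:R + e * (m i == a)%:R) = e ^+ c.
  rewrite -prodrXr; apply: eq_bigr => i _.
  case/orP: (m0a i) => /eqP ->; last by rewrite eqxx (gtn_eqF a_gt0) add0r mulr1 expr1.
  by rewrite eqxx (ltn_eqF a_gt0) mulr0 addr0.
have mdegc : mdeg m = (a * c)%N.
  rewrite mdegE big_distrr; apply: eq_bigr => i _.
  case/orP: (m0a i) => /eqP ->; first by rewrite (ltn_eqF a_gt0) /= muln0.
  by rewrite eqxx /= muln1.
have nzE : nzparts m = nseq c a.
  have {}m_all : nzparts m = nseq (size (nzparts m)) a.
    apply/all_pred1P/allP => x xm; have := allP m_all x xm.
    by case/orP => // /eqP x0; move: xm; rewrite x0 mem_filter eqxx.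
  rewrite {1}m_all; congr nseq; apply/eqP; rewrite -(eqn_pmul2l a_gt0).
  by rewrite -sumn_nseq -m_all sumn_nzparts sumn_mdeg mdegc.
rewrite nzE mdegc eqn_pmul2l // leq_pmul2l //.
have [->|cj] := eqVneq c j; first by rewrite leqnn perm_refl mulr1 mul1r.
case: andP => [[_ /perm_size]|]; last by rewrite mulr0 mul0r.
by rewrite !size_nseq => /eqP; rewrite (negbTE cj).
Qed.

Lemma eq_coef_prod (S : comNzRingType) (I : Type) (r : seq I) D (F G : I -> {poly S}) :
  (forall i d, (d <= D)%N -> (F i)`_d = (G i)`_d) ->
  forall d, (d <= D)%N -> (\prod_(i <- r) F i)`_d = (\prod_(i <- r) G i)`_d.
Proof.
move=> FG; elim: r => [|i r IH] d dD; first by rewrite !big_nil.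
rewrite !big_cons !coefM; apply: eq_bigr => j _.
by rewrite FG ?IH //; have := ltn_ord j; lia.
Qed.

Lemma coef_series_prodM n D (b c : nat -> R) d : (d <= D)%N ->
  (series_prod n D b * series_prod n D c)`_d =
  (series_prod n D (fun e => \sum_(j < e.+1) b j * c (e - j)%N))`_d.
Proof.
move=> dD; rewrite /series_prod -big_split /=.
apply: (eq_coef_prod _ _ _ D) => // i e eD.
rewrite coefM coef_poly ltnS eD scaler_suml; apply: eq_bigr => j _.
have je := ltn_ord j; rewrite !coef_poly ifT ?ifT; try lia.
by rewrite -scalerAl -scalerAr scalerA -exprD subnKC.
Qed.

Lemma series_prod_multiples n D a (c : nat -> R) d : (d <= D)%N ->
  (forall i, ~~ (a %| i)%N -> c i = 0) -> ~~ (a %| d)%N -> (series_prod n D c)`_d = 0.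
Proof.
move=> dD c0 ad; apply/mpolyP => m; rewrite mcoeff_series_prod // mcoeff0.
have [/forallP am|] := boolP [forall i, a %| m i]%N; last first.
  by rewrite negb_forall => /existsP[i /c0 ci]; rewrite (bigD1 i) //= ci mul0r mulr0.
have /negbTE -> : mdeg m != d; last by rewrite mul0r.
by apply: contraNneq ad => <-; rewrite mdegE dvdn_sum.
Qed.

Lemma sum_multiples (V : zmodType) (a k : nat) (F : nat -> V) : (0 < a)%N ->
  (forall i, (i <= a * k)%N -> ~~ (a %| i)%N -> F i = 0) ->
  \sum_(i < (a * k).+1) F i = \sum_(j < k.+1) F (a * j)%N.
Proof.
move=> a_gt0; elim: k => [|k IH] F0; first by rewrite muln0 !big_ord1 muln0.
rewrite [RHS]big_ord_recr /= -IH => [|i ik]; last by apply: F0; nia.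
rewrite -!(big_mkord xpredT F) (@big_cat_nat _ _ _ (a * k).+1) //=; last by nia.
congr (_ + _).
have -> : (a * k.+1).+1 = (a * k + a).+1 by rewrite mulnS addnC.
rewrite big_nat_recr /=; last first.
  by rewrite -[X in (X <= _)%N]addn1 leq_add2l.
rewrite big_nat_cond big1 ?add0r; first by rewrite mulnS addnC.
move=> i /andP[ik _]; apply: F0; first by nia.
apply/negP => /dvdnP[j ij]; move: ik; rewrite ij (mulnC j) ltn_pmul2l // -mulnSr.
by rewrite ltn_pmul2l // ltnS; case: ltngtP.
Qed.

(** Compare coefficients in
    (1 - x^a u^a) (1 + x u + x^2 u^2 + ...) = 1 + x u + ... + (x u)^(a-1),
    multiplied over all variables x. *)
Lemma petrie_mono_homsym a k : (0 < a)%N ->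
  \sum_(j < k.+1) (-1) ^+ j *: mono R (nseq j a) * homsym R (a * (k - j)) =
  petrie R a (a * k).
Proof.
move=> a_gt0; apply: symfunP => n.
rewrite (big_morph (fun f : symfun R => f n) (id1 := 0) (op1 := +%R)) //=.
rewrite (petrie_series _ (a * k)) //.
pose c := fun i => (i == 0%N)%:R + (-1) * (i == a)%:R : R.
transitivity ((series_prod n (a * k) c * series_prod n (a * k) (fun=> 1))`_(a * k)).
  rewrite coefM (sum_multiples _ a k (fun i => _`_i * _`_(a * k - i))) //; last first.
    move=> i ik ai; rewrite (series_prod_multiples _ _ a) ?mul0r //.
    move=> {ik} {}i {}ai; rewrite /c.
    have [ii|_] := eqVneq i a; first by rewrite ii dvdnn in ai.
    have [i0|_] := eqVneq i 0%N; first by rewrite i0 dvdn0 in ai.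
    by rewrite /= mulr0 addr0.
  apply: eq_bigr => j _; have jk := ltn_ord j.
  rewrite -(mono_series _ (a * k)) -?homsym_series ?leq_subr ?leq_pmul2l //.
  by rewrite -mulnBr.
rewrite coef_series_prodM //.
congr (nth 0 (polyseq _) _); rewrite /series_prod; apply: eq_bigr => i _.
apply/eq_poly => e _; congr (_ *: _).
under eq_bigr => j _ do rewrite mulr1.
rewrite big_split /= -mulr_sumr -!natr_sum.
have sum1 x : (\sum_(j < e.+1) (j == x :> nat))%N = (x <= e)%N.
  case: leqP => xe.
    rewrite (bigD1 (Ordinal (xe : x < e.+1)%N)) //= eqxx big1 // => j /eqP jx.
    by case: eqP => // jx'; case: jx; apply/val_inj.
  by rewrite big1 // => j _; have := ltn_ord j; case: eqP => // ->; lia.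
rewrite !sum1 mulN1r ltnNge.
by case: (a <= e)%N; rewrite ?subrr ?subr0.
Qed.

End GeneratingProducts.

(** * Evaluating symmetric functions on finite alphabets *)

Definition elemgen {A : comNzRingType} (s : seq A) : {poly A} :=
  \prod_(x <- s) (1 + x *: 'X).

Lemma elemgenS (A : comNzRingType) (x : A) s j :
  (elemgen (x :: s))`_j.+1 = (elemgen s)`_j.+1 + x * (elemgen s)`_j.
Proof.
by rewrite /elemgen big_cons mulrDl mul1r coefD -scalerAl coefZ coefXM.
Qed.

(** The substitution u -> u^a turns the product of the 1 + x^a u into the
    generating product of [mono_series]. *)
Lemma mono_elemgen (R : comNzRingType) a j n : (0 < a)%N ->
  mono R (nseq j a) n = (\prod_(i < n) (1 + 'X_i ^+ a *: 'X))`_j.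
Proof.
move=> a_gt0; have jD : (a * j <= a * j + a)%N by rewrite leq_addr.
(* D = a j + a: the factors must contain u^a even if j = 0 *)
rewrite -[LHS]scale1r -(expr1n R j) (mono_series _ _ _ _ _ _ a_gt0 jD).
set p := \prod_(i < n) _.
have -> : p`_j = (p \Po 'X^a)`_(a * j).
  by rewrite coef_comp_poly_Xn // dvdn_mulr // mulKn.
congr (nth 0 (polyseq _) _); rewrite rmorph_prod /series_prod /=; apply: eq_bigr => i _.
rewrite comp_polyD comp_polyZ comp_polyX -polyC1 comp_polyC.
apply/polyP => d; rewrite coef_poly coefD coefC coefZ coefXn mul1r.
have [->|d0] := eqVneq d 0%N.
  by rewrite ltnS leq0n (ltn_eqF a_gt0) mulr0 !addr0 expr0 scale1r.
have [->|da] := eqVneq d a; last by rewrite add0r mulr0 add0r scale0r if_same.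
by rewrite ltnS leq_addl !add0r mulr1 scale1r.
Qed.

Section Evaluation.
Context {R A : comNzRingType} (h : {rmorphism R -> A}).

(** Alphabets are sequences, so that adding a variable is consing and adding c
    copies of it is concatenating a constant sequence. *)
Definition sfeval (s : seq A) (f : symfun R) : A :=
  mmap h (fun i : 'I_(size s) => s`_i) (f (size s)).

Fact sfeval_is_zmod_morphism s : zmod_morphism (sfeval s).
Proof. by move=> f g; rewrite /sfeval /= mmapB. Qed.
HB.instance Definition _ s := GRing.isZmodMorphism.Build (symfun R) A (sfeval s)
  (sfeval_is_zmod_morphism s).

Fact sfeval_is_monoid_morphism s : monoid_morphism (sfeval s).
Proof. by split=> [|f g]; rewrite /sfeval /= ?rmorph1 ?rmorphM. Qed.
HB.instance Definition _ s := GRing.isMonoidMorphism.Build (symfun R) A (sfeval s)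
  (sfeval_is_monoid_morphism s).

Lemma sfevalZ s c f : sfeval s (c *: f) = h c * sfeval s f.
Proof. by rewrite /sfeval /= mmapZ. Qed.

Lemma sfeval_psumS s i : sfeval s (psumS R i) = \sum_(x <- s) x ^+ i.+1.
Proof.
rewrite /sfeval /= rmorph_sum /= (big_nth 0) big_mkord.
by apply: eq_bigr => j _; rewrite rmorphXn /= mmapX mmap1U.
Qed.

Lemma sfeval_mono a j s : (0 < a)%N ->
  sfeval s (mono R (nseq j a)) = (elemgen [seq x ^+ a | x <- s])`_j.
Proof.
move=> a_gt0; rewrite /sfeval mono_elemgen // -coef_map rmorph_prod /=.
rewrite /elemgen big_map (big_nth 0) big_mkord.
congr (nth 0 (polyseq _) _); apply: eq_bigr => i _.
by rewrite rmorphD rmorph1 /= map_polyZ map_polyX rmorphXn /= mmapX mmap1U.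
Qed.

Lemma mmap_sfeval m (v : m.-tuple A) (f : symfun R) :
  mmap h (tnth v) (f m) = sfeval v f.
Proof.
case: v => s sz; have sz' := eqP sz; case: m / sz' in sz *.
apply: eq_bigr => k _; congr (_ * _); apply: mmap1_eq => i.
by rewrite (tnth_nth 0).
Qed.

End Evaluation.

(** Evaluating f on the alphabet of n variables recovers its n-th component. *)
Lemma symfun_evalP (R : comNzRingType) (f g : symfun R) :
  (forall n (s : seq {mpoly R[n]}), sfeval (@mpolyC n R) s f = sfeval (@mpolyC n R) s g) ->
  f = g.
Proof.
move=> fg; apply: symfunP => n.
rewrite -[f n]comp_mpoly_id -[g n]comp_mpoly_id /comp_mpoly !mmap_sfeval.
exact: fg.
Qed.

Lemma rmorph_mmap (n : nat) (R S T : comNzRingType) (f : {rmorphism R -> S})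
    (g : {rmorphism S -> T}) (v : 'I_n -> S) (p : {mpoly R[n]}) :
  g (mmap f v p) = mmap (g \o f) (g \o v) p.
Proof.
rewrite /mmap rmorph_sum; apply: eq_bigr => m _; rewrite rmorphM /mmap1 rmorph_prod.
by congr (_ * _); apply: eq_bigr => i _; rewrite rmorphXn.
Qed.

Lemma eq_mmap (n : nat) (R S : comNzRingType) (f g : R -> S)
    (v w : 'I_n -> S) (p : {mpoly R[n]}) : f =1 g -> v =1 w -> mmap f v p = mmap g w p.
Proof.
move=> fg vw; apply: eq_bigr => m _; rewrite fg; congr (_ * _).
exact: mmap1_eq.
Qed.

Lemma rmorph_sfeval (R S T : comNzRingType) (h : {rmorphism R -> S})
    (g : {rmorphism S -> T}) (s : seq S) (f : symfun R) :
  g (sfeval h s f) = sfeval (g \o h) (map g s) f.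
Proof.
rewrite -(mmap_sfeval _ _ (in_tuple s)) -(mmap_sfeval _ _ (map_tuple g (in_tuple s))).
by rewrite rmorph_mmap; apply: eq_mmap => // i; rewrite /= tnth_map.
Qed.

Lemma mono_nil (R : comNzRingType) : mono R [::] = 1.
Proof.
rewrite -[[::]]/(nseq 0 1%N); apply: symfun_evalP => n s.
rewrite rmorph1 sfeval_mono // /elemgen big_map -horner_coef0 horner_prod.
by rewrite big1 // => x _; rewrite !hornerE ?mulr0 ?addr0.
Qed.

(** * Newton identities *)

(** Induction on the alphabet: adding y changes the elementary functions by
    e_j -> e_j + y e_(j-1), and the contribution of the powers of y to the
    right-hand side telescopes. *)
Lemma newton_identity (A : comNzRingType) (s : seq A) j :
  (elemgen s)`_j *+ j =
  \sum_(r < j) (-1) ^+ r * (elemgen s)`_(j.-1 - r) * \sum_(x <- s) x ^+ r.+1.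
Proof.
elim: s j => [|y s IH] j.
  under eq_bigr => r _ do rewrite big_nil mulr0.
  by rewrite /elemgen big_nil coef1 big1_eq; case: j => //= j; rewrite mul0rn.
case: j => [|j]; first by rewrite big_ord0.
have e0 : (elemgen (y :: s))`_0 = (elemgen s)`_0.
  by rewrite /elemgen big_cons mulrDl mul1r coefD -scalerAl coefZ coefXM mulr0 addr0.
(* the contribution of the powers of y *)
have alt i : \sum_(r < i.+1) (-1) ^+ r * (elemgen (y :: s))`_(i - r) * y ^+ r.+1 =
    y * (elemgen s)`_i.
  elim: i => [|i IHi]; first by rewrite big_ord1 expr0 mul1r subnn e0 mulrC.
  rewrite big_ord_recl expr0 mul1r subn0 elemgenS expr1.
  under eq_bigr => r _ do rewrite lift0 subSS exprS (exprS y r.+1) mulN1r !mulNr mulrCA.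
  by rewrite sumrN -mulr_sumr IHi; ring.
under eq_bigr => r _ do rewrite big_cons mulrDr.
rewrite big_split /= alt elemgenS mulrnDl IH /= [X in _ = _ + X]big_ord_recr /= subnn e0.
have -> : \sum_(r < j) (-1) ^+ r * (elemgen (y :: s))`_(j - r) * (\sum_(x <- s) x ^+ r.+1) =
  \sum_(r < j) (-1) ^+ r * (elemgen s)`_(j - r) * (\sum_(x <- s) x ^+ r.+1) +
  y * ((elemgen s)`_j *+ j).
  rewrite IH mulr_sumr -big_split; apply: eq_bigr => r _ /=.
  have -> : (j - r)%N = (j.-1 - r).+1 by have := ltn_ord r; lia.
  by rewrite elemgenS; ring.
rewrite [in LHS]big_ord_recr /= subnn mulrS -mulrnAr.
ring.
Qed.

(** The Newton identity in the alphabet of the a-th powers, whose power sums are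
    the p_(a r). *)
Lemma mono_newton (R : comNzRingType) (a j : nat) : (0 < a)%N ->
  mono R (nseq j a) *+ j =
  \sum_(r < j) (-1) ^+ r * mono R (nseq (j.-1 - r) a) * psumS R (a * r.+1).-1.
Proof.
move=> a_gt0; apply: symfun_evalP => n s; rewrite rmorphMn rmorph_sum /=.
rewrite sfeval_mono // newton_identity; apply: eq_bigr => r _.
rewrite !rmorphM rmorphXn rmorphN1 /= sfeval_mono // sfeval_psumS big_map.
congr (_ * _); apply: eq_bigr => x _.
by rewrite prednK ?muln_gt0 ?a_gt0 // exprM.
Qed.

(** * Substitution of power sums *)

Lemma poly_eq_on_nat (B : idomainType) (p r : {poly B}) :
  injective (fun c : nat => c%:R : B) ->
  (forall c : nat, p.[c%:R] = r.[c%:R]) -> p = r.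
Proof.
move=> inj pr; apply/eqP; rewrite -subr_eq0; apply/negPn/negP => pr0.
have := @max_poly_roots _ (p - r) [seq c%:R | c <- iota 0 (size (p - r))] pr0.
rewrite size_map size_iota ltnn map_inj_uniq ?iota_uniq // => /(_ _ isT) H.
suff /H : all (root (p - r)) [seq c%:R | c <- iota 0 (size (p - r))] by [].
by apply/allP => _ /mapP[c _ ->]; rewrite rootE hornerD hornerN pr subrr.
Qed.

Section PowerSums.
Variable F : fieldType.
Hypothesis natF : forall n, n.+1%:R != 0 :> F.

Lemma natr_inj_codomain (B : idomainType) (h : {rmorphism F -> B}) :
  injective (fun c : nat => c%:R : B).
Proof.
move=> c d /= cd; wlog le_cd : c d cd / (c <= d)%N => [H|].
  by case/orP: (leq_total c d) => [/H|/(fun l => H d c (esym cd) l)] -> //.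
move/eqP: cd; rewrite eq_sym -subr_eq0 -natrB // -(rmorph_nat h) fmorph_eq0.
by case: (d - c)%N (subnKC le_cd) => [<-|e _]; rewrite ?addn0 // (negbTE (natF _)).
Qed.

Definition psum_eval N (p : {mpoly F[N]}) : symfun F :=
  mmap (GRing.in_alg (symfun F)) (fun i => psumS F i) p.

(** Solve the Newton identities for the m_j one after the other; this divides
    by j, hence the characteristic 0. The sequence Q lists the expressions that
    have been found so far. *)
Lemma mono_psum_expansion a k : (0 < a)%N ->
  exists p : {mpoly F[(a * k).+1]}, psum_eval _ p = mono F (nseq k a).
Proof.
move=> a_gt0.
suff H : forall j, (j <= k)%N -> exists Q : nat -> {mpoly F[(a * k).+1]},
    forall i, (i <= j)%N -> psum_eval _ (Q i) = mono F (nseq i a).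
  by have [Q QE] := H k (leqnn k); exists (Q k); exact: QE.
elim=> [_|j IH jk].
  exists (fun=> 1) => i; rewrite leqn0 => /eqP -> /=.
  by rewrite /psum_eval rmorph1 mono_nil.
have [Q QE] := IH (ltnW jk).
(* the variable of index i stands for p_(i+1) *)
pose new := (j.+1%:R)^-1 *:
  \sum_(r < j.+1) (-1) ^+ r * Q (j - r)%N * 'X_(inord (a * r.+1).-1).
exists (fun i => if i == j.+1 then new else Q i) => i ij.
case: eqP => [->|/eqP iN]; last by apply: QE; rewrite -ltnS ltn_neqAle iN.
rewrite /psum_eval mmapZ mulr_algl.
apply: (can_inj (scalerK (natF j))); rewrite scalerKV // scaler_nat mono_newton //.
rewrite rmorph_sum; apply: eq_bigr => r _.
rewrite !rmorphM rmorphXn rmorphN1 /= mmapX mmap1U -/(psum_eval _ _) QE ?leq_subr //.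
by rewrite inordK //; have := ltn_ord r; nia.
Qed.

Variable qi : F.

(** With qi = 1/q and 'X = 1/z, the substitution of X - (1 - 1/q)/z for X. *)
Definition shift_psums N (p : {mpoly F[N]}) : {poly symfun F} :=
  mmap (polyC \o GRing.in_alg (symfun F))
    (fun i => (psumS F i)%:P - ((1 - qi ^+ i.+1)%:A)%:P * 'X^(i.+1)) p.

Section Interpolation.
Variables (B : idomainType) (h : {rmorphism F -> B}) (s : seq B) (y : B).

(** The value of an expression in the power sums when p_i is evaluated on the
    alphabet s, the letter qi y and 'X copies of the letter y. The number of
    copies is an indeterminate and may be specialized to -1. *)
Definition interp N (p : {mpoly F[N]}) : {poly B} :=
  mmap (polyC \o h) (fun i : 'I_N =>
    (\sum_(x <- h qi * y :: s) x ^+ i.+1)%:P + (y ^+ i.+1)%:P * 'X) p.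

Lemma interp_nat N (p : {mpoly F[N]}) (c : nat) :
  (interp _ p).[c%:R] = sfeval h (nseq c y ++ h qi * y :: s) (psum_eval _ p).
Proof.
rewrite -[LHS]/(horner_eval _ _) /interp /psum_eval !rmorph_mmap.
apply: eq_mmap => [u|i] /=.
  by rewrite horner_evalE hornerC sfevalZ rmorph1 mulr1.
rewrite horner_evalE hornerD hornerM !hornerC hornerX sfeval_psumS big_cat /= addrC.
by rewrite big_nseq iter_addr_0 mulr_natr.
Qed.

(** For natural c, going from c to c + 1 adds the letter y and hence adds y^a
    times the value for m_j to the value for m_(j+1). As an identity between
    polynomials in c this also holds at c = -1, and there the value at
    c + 1 = 0 is the evaluation on the alphabet s with the letter qi y. *)
Lemma interp_step a j N N' (p : {mpoly F[N]}) (p' : {mpoly F[N']}) : (0 < a)%N ->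
  psum_eval _ p = mono F (nseq j.+1 a) -> psum_eval _ p' = mono F (nseq j a) ->
  (interp _ p).[-1] + y ^+ a * (interp _ p').[-1] =
    sfeval h s (mono F (nseq j.+1 a)) + (h qi * y) ^+ a * sfeval h s (mono F (nseq j a)).
Proof.
move=> a_gt0 pE p'E.
have E : interp _ p \Po ('X + 1) = interp _ p + (y ^+ a) *: interp _ p'.
  apply: poly_eq_on_nat => [|c]; first exact: natr_inj_codomain h.
  rewrite horner_comp !hornerE natr1 !interp_nat pE p'E !sfeval_mono //=.
  exact: elemgenS.
have := congr1 (horner^~ (-1)) E; rewrite horner_comp !hornerE addNr => <-.
by rewrite (interp_nat _ p 0) pE !sfeval_mono //= elemgenS.
Qed.

End Interpolation.

(** Replacing p_i by p_i - (1 - qi^i) 'X^i amounts to adding the letter qi 'X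
    and -1 copies of the letter 'X. *)
Lemma map_shift_psums (A : idomainType) (h : {rmorphism F -> A}) (s : seq A) N
    (p : {mpoly F[N]}) :
  map_poly (sfeval h s) (shift_psums _ p) =
  (interp _ (polyC \o h) (map polyC s) 'X _ p).[-1].
Proof.
rewrite -[RHS]/(horner_eval _ _) /interp /shift_psums !rmorph_mmap.
apply: eq_mmap => [u|i] /=.
  by rewrite horner_evalE hornerC map_polyC /= sfevalZ rmorph1 mulr1.
rewrite horner_evalE !hornerE rmorphB rmorphM /= !map_polyC map_polyXn /= sfeval_psumS.
rewrite sfevalZ rmorph1 mulr1 big_cons big_map rmorph_sum rmorphB rmorphXn rmorph1 /=.
rewrite exprMn.
under [in RHS]eq_bigr => x _ do rewrite -rmorphXn.
by rewrite rmorphB rmorph1 rmorphXn /=; ring.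
Qed.

Lemma shift_psums_step a j N N' (p : {mpoly F[N]}) (p' : {mpoly F[N']}) : (0 < a)%N ->
  psum_eval _ p = mono F (nseq j.+1 a) -> psum_eval _ p' = mono F (nseq j a) ->
  shift_psums _ p + 'X^a * shift_psums _ p' =
   (mono F (nseq j.+1 a))%:P + (qi ^+ a *: mono F (nseq j a))%:P * 'X^a.
Proof.
move=> a_gt0 pE p'E; apply/polyP => i; apply: symfun_evalP => n s.
rewrite -!coef_map rmorphD [in RHS]rmorphD !rmorphM /=.
rewrite !map_shift_psums !map_polyC map_polyXn /=.
congr (nth 0 (polyseq _) _).
rewrite (interp_step _ _ _ _ _ _ _ _ _ _ a_gt0 pE p'E).
rewrite -!rmorph_sfeval sfevalZ rmorphM rmorphXn /= exprMn rmorphXn.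
by rewrite mulrAC.
Qed.

Lemma shift_psums_1 N (p : {mpoly F[N]}) : psum_eval _ p = 1 -> shift_psums _ p = 1.
Proof.
move=> p1; apply/polyP => i; apply: symfun_evalP => n s.
rewrite -!coef_map rmorph1 map_shift_psums.
congr (nth 0 (polyseq _) _).
have -> : interp _ (polyC \o mpolyC n (R:=F)) [seq c%:P | c <- s] 'X N p = 1.
  apply: poly_eq_on_nat => [|c]; last first.
    by rewrite interp_nat p1 rmorph1 hornerC.
  exact: (natr_inj_codomain _ (polyC \o mpolyC n (R:=F))).
by rewrite hornerC.
Qed.

End PowerSums.

(** * Pairing with the complete homogeneous functions *)

Section Pairing.
Variable R : comNzRingType.
Implicit Types g : {poly symfun R}.

(** The coefficient of z^b in g(1/z) Omega[zX]. *)
Definition hpairing (b : nat) g : symfun R :=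
  \sum_(j < size g) g`_j * homsym R (b + j).

Lemma hpairingE L b g : (size g <= L)%N ->
  hpairing b g = \sum_(j < L) g`_j * homsym R (b + j).
Proof.
move=> gL; rewrite /hpairing -(big_mkord xpredT (fun j => g`_j * homsym R (b + j))).
rewrite (big_nat_widen _ _ _ _ _ gL) big_mkord big_mkcond; apply: eq_bigr => j _ /=.
by case: ltnP => // gj; rewrite nth_default // mul0r.
Qed.

Lemma hpairingD b g g' : hpairing b (g + g') = hpairing b g + hpairing b g'.
Proof.
pose L := maxn (size g) (size g').
rewrite !(hpairingE L) ?leq_maxl ?leq_maxr ?size_polyD // -big_split /=.
by apply: eq_bigr => j _; rewrite coefD mulrDl.
Qed.

Lemma hpairingC b c : hpairing b c%:P = c * homsym R b.
Proof. by rewrite (hpairingE 1) ?size_polyC_leq1 // big_ord1 coefC addn0. Qed.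

Lemma hpairingCM b c g : hpairing b (c%:P * g) = c * hpairing b g.
Proof.
rewrite !(hpairingE (size g)) // ?mul_polyC ?size_scale_leq // mulr_sumr.
by apply: eq_bigr => j _; rewrite coefZ mulrA.
Qed.

Lemma hpairingXnM b a g : hpairing b ('X^a * g) = hpairing (b + a) g.
Proof.
rewrite (hpairingE (a + size g)); last first.
  by apply: leq_trans (size_polyMleq _ _) _; rewrite size_polyXn.
rewrite big_split_ord /= big1 ?add0r => [|j _]; last by rewrite coefXnM ltn_ord mul0r.
by apply: eq_bigr => j _; rewrite coefXnM ltnNge leq_addr /= addKn addnA.
Qed.

End Pairing.

(** * The weighted sum *)

(** The recursion yields v_j = w_j + (1 - Q) (w_0 + ... + w_(j-1)). If T_k and
    S_k are the two sides, then T_(k+1) = Q T_k + v_k, which is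
    Q S_k + w_k + (1 - Q) S_k = S_(k+1). *)
Lemma telescope_weights (F : comNzRingType) (V : lmodType F) (Q : F) (v w : nat -> V) k :
  v 0%N = w 0%N -> (forall j, (j.+1 < k)%N -> v j.+1 - v j = w j.+1 - Q *: w j) ->
  \sum_(j < k) Q ^+ (k.-1 - j) *: v j = \sum_(j < k) w j.
Proof.
move=> v0 vS.
have H j : (j < k)%N -> v j = w j + (1 - Q) *: \sum_(i < j) w i.
  elim: j => [_|j IH jk]; first by rewrite big_ord0 scaler0 addr0.
  rewrite -[LHS](subrK (v j)) vS // IH ?(ltnW jk) // big_ord_recr /=.
  rewrite scalerDr; set X := (1 - Q) *: \sum_(i < j) _.
  have -> : (1 - Q) *: w j = w j - Q *: w j by rewrite scalerBl scale1r.
  by rewrite -!addrA; congr (_ + _); rewrite addrC (addrC (w j)) -addrA.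
elim: k H {vS} => [|k IH] H; first by rewrite !big_ord0.
rewrite !big_ord_recr /= subnn expr0 scale1r H //.
have -> : \sum_(i < k) Q ^+ (k - i) *: v i = Q *: \sum_(i < k) w i.
  rewrite -IH => [|j jk]; last by apply: H; apply: ltnW.
  rewrite scaler_sumr; apply: eq_bigr => j _; rewrite scalerA -exprS.
  by congr (_ ^+ _ *: _); have := ltn_ord j; lia.
by rewrite addrCA -scalerDl addrCA subrr addr0 scale1r addrC.
Qed.

Lemma alternate_step (F : comNzRingType) (V : lmodType F) (Q : F) (x y z w : V) j :
  x + y = z + Q *: w ->
  (-1) ^+ j.+1 *: x - (-1) ^+ j *: y = (-1) ^+ j.+1 *: z - Q *: ((-1) ^+ j *: w).
Proof.
move=> /(congr1 (fun u => (-1) ^+ j.+1 *: u)); rewrite !scalerDr.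
by rewrite exprS mulN1r !scaleNr !scalerA (mulrC Q).
Qed.

(** The sign and the power of q in front of a term of the theorem. With x for
    q, a.+1 for the a of the theorem and i.+1 for its summation index, j + i.+1
    is its k, and the sign splits into one common to all terms and (-1) ^+ j. *)
Lemma sign_power_identity (F : fieldType) (x : F) (a i j : nat) : x != 0 ->
  x ^+ a * ((- x^-1) ^+ (a.+1 * i.+1 - 1) * (-1) ^+ (a * j)) =
  - ((-1) ^+ (a * (j + i.+1)) * (-1) ^+ (j + i.+1)) * ((x^-1 ^+ a.+1) ^+ i * (-1) ^+ j).
Proof.
move=> x0.
have -> : (a.+1 * i.+1 - 1 = a + a.+1 * i)%N by rewrite mulnS; lia.
rewrite (exprNn x^-1) [x^-1 ^+ (_ + _)]exprD -exprM.
have sgE m n : odd m = odd n -> (-1) ^+ m = (-1) ^+ n :> F.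
  by move=> mn; rewrite -signr_odd mn signr_odd.
have sgn : (-1) ^+ (a + a.+1 * i) * (-1) ^+ (a * j) =
   - ((-1) ^+ (a * (j + i.+1)) * (-1) ^+ (j + i.+1)) * (-1) ^+ j :> F.
  (* write the outer sign as (-1) ^+ 1 to collect all exponents *)
  rewrite [RHS]mulNr -[RHS]mul1r mulrN -mulNr -[- 1]expr1 -!exprD.
  apply: sgE; rewrite !(oddD, oddM, oddS, oddX) /=.
  by case: (odd a); case: (odd i); case: (odd j).
have xa : x ^+ a * x^-1 ^+ a = 1 by rewrite -exprMn divff ?expr1n.
transitivity ((x ^+ a * x^-1 ^+ a) * x^-1 ^+ (a.+1 * i) *
    ((-1) ^+ (a + a.+1 * i) * (-1) ^+ (a * j))).
  by ring.
by rewrite xa mul1r sgn; ring.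
Qed.

(** * The operators C_b over Q(q,t) *)

Lemma Qqt_natr_neq0 n : n.+1%:R != 0 :> Qqt.
Proof.
rewrite -(rmorph_nat (@tofrac _)) tofrac_eq0 -mpolyC_nat mpolyC_eq0.
by rewrite Num.Theory.pnatr_eq0.
Qed.

Lemma q_neq0 : q != 0.
Proof.
rewrite tofrac_eq0; apply/eqP => /(congr1 (mcoeff U_(ord0)%MM)).
by rewrite mcoeffX eqxx mcoeff0.
Qed.

Lemma pexpansionK (a k : nat) (c : Qqt) : (0 < a)%N ->
  peval (pexpansion (c *: mono Qqt (nseq k a))) = c *: mono Qqt (nseq k a).
Proof.
move=> a_gt0; rewrite /pexpansion; case: pselect => [H|[]]; first exact: (projT2 (cid H)).
have [p pE] := mono_psum_expansion _ Qqt_natr_neq0 a k a_gt0.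
exists (existT (fun N => {mpoly Qqt[N]}) _ (c *: p)); rewrite /peval /= mmapZ mulr_algl.
by congr (_ *: _).
Qed.

(** The theorem applies C_b to c m_j with a sign c. Since c * c = 1, multiplying
    the chosen expression of c m_j by c gives an expression of m_j. *)
Definition mono_expansion (a j : nat) (c : Qqt) :=
  c *: tagged (pexpansion (c *: mono Qqt (nseq j a))).

Lemma mono_expansionK a j c : (0 < a)%N -> c * c = 1 ->
  psum_eval _ _ (mono_expansion a j c) = mono Qqt (nseq j a).
Proof.
move=> a_gt0 cc; rewrite /mono_expansion /psum_eval mmapZ mulr_algl.
by rewrite [X in _ *: X](pexpansionK _ _ _ a_gt0) scalerA cc scale1r.
Qed.

Lemma Cop_mono a j (c : Qqt) b : (0 < a)%N -> (0 < b)%N -> c * c = 1 ->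
  Cop b%:Z (c *: mono Qqt (nseq j a)) =
  ((- q^-1) ^+ (b - 1) * c) *: hpairing _ b (shift_psums _ q^-1 _ (mono_expansion a j c)).
Proof.
move=> a_gt0 b_gt0 cc; rewrite /Cop.
set g := plethsub _.
have -> : shift_psums _ q^-1 _ (mono_expansion a j c) = (c%:A)%:P * g by apply: mmapZ.
rewrite hpairingCM mulr_algl scalerA -mulrA cc mulr1 (subzn b_gt0 : b%:Z - 1 = _).
by congr (_ *: _).
Qed.

Theorem theorem3p7 (a k : nat) (ha : (0 < a)%N) (hk : (0 < k)%N) :
  (-1) ^+ ((a - 1) * k) *: mono Qqt (nseq k a) =
    q ^+ (a - 1) *:
      (\sum_(1 <= i < k.+1)
         Cop (a * i)%N%:Z ((-1) ^+ ((a - 1) * (k - i)) *: mono Qqt (nseq (k - i) a)))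
    + (-1) ^+ (a * k) *: petrie Qqt a (a * k) :> Lambda.
Proof.
pose c j : Qqt := (-1) ^+ ((a - 1) * j).
have cc j : c j * c j = 1 by rewrite -expr2 -exprM mulnC exprM sqrrN expr1n expr1n.
(* the coefficient of z^b in m_j[X - (1 - 1/q)/z] Omega[zX] *)
pose v j b := hpairing _ b (shift_psums _ q^-1 _ (mono_expansion a j (c j))).
have v0 b : v 0%N b = homsym Qqt b.
  rewrite /v shift_psums_1; last first.
  - by rewrite mono_expansionK // mono_nil.
  - exact: Qqt_natr_neq0.
  by rewrite -polyC1 hpairingC mul1r.
have vS j b : v j.+1 b + v j (b + a)%N =
    mono Qqt (nseq j.+1 a) * homsym Qqt b +
    (q^-1) ^+ a *: (mono Qqt (nseq j a) * homsym Qqt (b + a)).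
  rewrite /v -hpairingXnM -hpairingD.
  rewrite (shift_psums_step _ Qqt_natr_neq0 _ a j _ _ _ _ ha) ?mono_expansionK //.
  rewrite hpairingD hpairingC -['X^a]mulr1 hpairingCM hpairingXnM.
  by rewrite -polyC1 hpairingC mul1r -scalerAl.
pose V j := (-1) ^+ j *: v j (a * (k - j))%N.
pose W j := (-1) ^+ j *: mono Qqt (nseq j a) * homsym Qqt (a * (k - j)).
have VW : \sum_(j < k) (q^-1 ^+ a) ^+ (k.-1 - j) *: V j = \sum_(j < k) W j.
  apply: telescope_weights => [|j jk].
    by rewrite /V /W !expr0 v0 !scale1r mono_nil mul1r.
  have ek : (a * (k - j) = a * (k - j.+1) + a)%N.
    by rewrite -mulnSr; congr (_ * _)%N; lia.
  rewrite /V /W -!scalerAl; apply: alternate_step.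
  by have := vS j (a * (k - j.+1))%N; rewrite -ek.
rewrite -(petrie_mono_homsym Qqt a k ha).
rewrite big_ord_recr /= subnn muln0 homsym0 mulr1 -VW.
have signs : (-1) ^+ (a * k) = c k * (-1) ^+ k.
  by rewrite -exprD -mulSnr subn1 prednK.
(* the index i of the theorem is k - j *)
have -> : q ^+ (a - 1) *: (\sum_(1 <= i < k.+1) Cop (a * i)%N%:Z
    ((-1) ^+ ((a - 1) * (k - i)) *: mono Qqt (nseq (k - i) a))) =
  - (-1) ^+ (a * k) *: \sum_(j < k) (q^-1 ^+ a) ^+ (k.-1 - j) *: V j.
  rewrite big_add1 /= big_mkord (reindex_inj rev_ord_inj) /= !scaler_sumr.
  apply: eq_bigr => j _; have jk := ltn_ord j.
  have -> : (k - j.+1).+1 = (k - j)%N by lia.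
  rewrite subKn; last exact: ltnW.
  rewrite -/(c j) (Cop_mono _ _ _ _ ha) ?muln_gt0 ?ha ?subn_gt0 //.
  rewrite -/(v _ _) /V !scalerA signs; congr (_ *: _).
  have := sign_power_identity _ q a.-1 (k - j.+1) j q_neq0.
  rewrite prednK // subnSK // subnKC; last exact: ltnW.
  rewrite -subn1 /c => ->.
  have -> : (k - j.+1 = k.-1 - j)%N by lia.
  exact: mulrA.
rewrite signs scaleNr scalerDr addKr scalerA.
by rewrite -mulrA -expr2 sqrr_sign mulr1.
Qed.
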